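(* Let $(a_1,a_2,\dots,a_m)$ be a composition of $n$. Set $A_1=\{1,\dots,a_1\}$, $A_2=\{a_1+1,\dots,a_1+a_2\}$, $\dots$, $A_m=\{a_1+\cdots+a_{m-1}+1,\dots,a_1+\cdots+a_m\}$. Then the Gelfand--Tsetlin basis (for the $S_{a_1}\times\cdots\times S_{a_m}$-invariant vectors) of $S^{n-1,1}$ with respect to the chain of subgroups $$S_n=S_{a_1+\cdots+a_m}\ \ge\ S_{a_1+\cdots+a_{m-1}}\times S_{a_m}\ \ge\ \cdots\ \ge\ S_{a_1+a_2}\times S_{a_3}\times\cdots\times S_{a_m}\ \ge\ S_{a_1}\times S_{a_2}\times\cdots\times S_{a_m}$$ is given by $$v_j=\sqrt{\frac{a_j}{(a_1+\cdots+a_{j-1})(a_1+\cdots+a_j)}}\;\mathbf{1}_{A_1\cup A_2\cup\cdots\cup A_{j-1}}-\sqrt{\frac{a_1+\cdots+a_{j-1}}{a_j(a_1+\cdots+a_j)}}\;\mathbf{1}_{A_j},\qquad j=m,m-1,\dots,2.$$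
   Context: A composition of $n$ is an ordered sequence of positive integers with sum $n$. $S^{n-1,1}=\{f:\{1,\dots,n\}\to\mathbb{C}:\sum_{i=1}^nf(i)=0\}$ with the action $(\sigma f)(i)=f(\sigma^{-1}(i))$ of $S_n$ and the inner product $\langle f_1,f_2\rangle=\sum_i f_1(i)\overline{f_2(i)}$; $\mathbf{1}_A$ is the characteristic function of $A$. In the chain, $S_{a_1+\cdots+a_j}$ permutes $A_1\cup\cdots\cup A_j$ and $S_{a_i}$ permutes $A_i$. Gelfand--Tsetlin basis: let $G=H_m\ge\cdots\ge H_1=K$ be a chain of subgroups such that for every $j$ and all irreducible representations $W$ of $H_{j+1}$ and $V$ of $H_j$ both containing nonzero $K$-invariant vectors, the multiplicity of $V$ in $\mathrm{Res}^{H_{j+1}}_{H_j}W$ is at most $1$ (the chain above has this property). Let $\mathcal{B}_j$ be the set of irreducible $H_j$-representations with nonzero $K$-invariant vectors. For an irreducible $G$-representation $(\rho,V)$ with $V^K\ne 0$ and a path $C:\rho_1,\dots,\rho_m=\rho$ with $\rho_j\in\mathcal{B}_j$ and $\rho_j$ contained in $\mathrm{Res}^{H_{j+1}}_{H_j}\rho_{j+1}$, there are unique subspaces $V=V_m\supseteq V_{m-1}\supseteq\cdots\supseteq V_1$ with $V_j$ an $H_j$-invariant subspace of $V_{j+1}$ isomorphic to $\rho_j$; $V_1$ is one-dimensional, consists of $K$-invariant vectors, and $v_C$ denotes a unit vector in it (determined up to a scalar of modulus 1). The Gelfand--Tsetlin basis of $V^K$ is the orthonormal basis $\{v_C\}$,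 $C$ running over all such paths. *)

(* Defs.v *)
From HB Require Import structures.
From mathcomp Require Import all_boot all_order all_algebra all_fingroup.
From mathcomp Require Import mxrepresentation.
From mathcomp Require Import complex reals.
Set Implicit Arguments.
Unset Strict Implicit.
Unset Printing Implicit Defensive.
Import Order.TTheory GRing.Theory Num.Theory.
Local Open Scope ring_scope.

(** ** Gelfand--Tsetlin bases

    Chains H_1 <= ... <= H_m are functions nat -> {group gT} of which only the
    values at 1, ..., m matter; the top group is H m and K is H 1.  Subspaces
    are row spaces of matrices, and a group element g acts on a row vector v
    by v *m rG g. *)

Section GelfandTsetlin.

Variables (C : numClosedFieldType) (gT : finGroupType).

(* Finite-dimensional representations of G, of unspecified dimension. *)
Record fdrep (G : {group gT}) := FdRep {
  fdrep_dim : nat;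
  fdrep_repr :> mx_representation C G fdrep_dim }.

(* K is a subgroup of G, the subspace U is K-invariant, and the representation
   of K on U is isomorphic to rho. *)
Definition affords (G K : {group gT}) n (rG : mx_representation C G n)
    (U : 'M[C]_n) (rho : fdrep K) : Prop :=
  exists (sKG : K \subset G) (modU : mxmodule (subg_repr rG sKG) U),
    mx_rsim rho (submod_repr modU).

(* rho is contained in the restriction of sigma to K. *)
Definition contained_in_Res (G K : {group gT}) (sigma : fdrep G)
    (rho : fdrep K) : Prop :=
  exists U, affords sigma U rho.

Variables (m : nat) (H : nat -> {group gT}).

(* rho_j belongs to B_j. *)
Definition spherical_irr j (rho : fdrep (H j)) : Prop :=
  mx_irreducible rho /\ rfix_mx rho (H 1%N) != 0.

Variables (n : nat) (rG : mx_representation C (H m) n) (V : 'M[C]_n).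

(* V is an H_m-submodule of C^n, with the inner product induced from C^n. *)

Definition GT_path (rho : forall j, fdrep (H j)) : Prop :=
  [/\ forall j, (1 <= j <= m)%N -> spherical_irr (rho j),
      forall j, (1 <= j < m)%N -> contained_in_Res (rho j.+1) (rho j)
    & affords rG V (rho m)].

Definition GT_flag (rho : forall j, fdrep (H j)) (W : nat -> 'M[C]_n) : Prop :=
  [/\ (W m == V)%MS,
      forall j, (1 <= j < m)%N -> (W j <= W j.+1)%MS
    & forall j, (1 <= j <= m)%N -> affords rG (W j) (rho j)].

Definition dotC (u v : 'rV[C]_n) : C := \sum_i u 0 i * (v 0 i)^*.

Definition GT_vector (rho : forall j, fdrep (H j)) (v : 'rV[C]_n) : Prop :=
  exists W, [/\ GT_flag rho W, (v <= W 1%N)%MS & dotC v v = 1].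

(* The vectors of s enumerate the Gelfand--Tsetlin basis of V^K.  Each v_C is
   only determined up to a scalar of modulus 1, and C only up to isomorphism of
   its members, whence the last two clauses.  Instead of assuming that the
   whole chain is multiplicity free, the third clause asks for what makes the
   basis of V^K well defined: existence and uniqueness of the flag of every
   path. *)
Definition is_GT_basis (s : seq 'rV[C]_n) : Prop :=
  [/\ forall i k, (i < size s)%N -> (k < size s)%N ->
        dotC s`_i s`_k = (i == k)%:R,
      ((\sum_(v <- s) <<v>>) == V :&: rfix_mx rG (H 1%N))%MS,
      forall rho, GT_path rho ->
        (exists W, GT_flag rho W) /\
        (forall W W', GT_flag rho W -> GT_flag rho W' ->
           forall j, (1 <= j <= m)%N -> (W j == W' j)%MS),
      forall rho, GT_path rho -> exists! v, v \in s /\ GT_vector rho v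
    & forall v, v \in s -> exists rho, GT_path rho /\ GT_vector rho v].

End GelfandTsetlin.

Arguments is_GT_basis {C gT} m H {n} rG V s.

(** ** The representation S^(n-1,1) *)

Section Standard.

Variables (C : numClosedFieldType) (n : nat).

Lemma perm_mx_is_repr (G : {group 'S_n}) :
  mx_repr G (fun s : 'S_n => perm_mx s : 'M[C]_n).
Proof. by split=> [|s t _ _]; rewrite ?perm_mx1 ?perm_mxM. Qed.

(* Functions {1, ..., n} -> C are row vectors in 'rV[C]_n. *)
Definition fun_repr (G : {group 'S_n}) : mx_representation C G n :=
  MxRepresentation (perm_mx_is_repr G).

Lemma fun_reprE (G : {group 'S_n}) (s : 'S_n) (f : 'rV[C]_n) (i : 'I_n) :
  (f *m fun_repr G s) 0 i = f 0 ((s^-1)%g i).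
Proof. by rewrite /= -{1}[s]invgK -col_permE mxE. Qed.

Definition std_space : 'M[C]_n := kermx (const_mx 1 : 'cV[C]_n).

Lemma std_spaceP (f : 'rV[C]_n) : (f <= std_space)%MS <-> \sum_i f 0 i = 0.
Proof.
have e : (f *m const_mx 1 : 'M_1) = (\sum_i f 0 i)%:M.
  apply/matrixP=> i j; rewrite !ord1 !mxE /= mulr1n.
  by apply: eq_bigr => k _; rewrite mxE mulr1.
rewrite (sameP sub_kermxP eqP) e; split=> [/eqP/matrixP/(_ 0 0)|->].
  by rewrite !mxE.
by rewrite raddf0.
Qed.

Definition ind_row (A : {set 'I_n}) : 'rV[C]_n := \row_i (i \in A)%:R.

End Standard.

(** ** Compositions, blocks and the chain of Young subgroups *)

Definition composition (n : nat) (a : seq nat) : bool :=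
  all (fun k => 0 < k)%N a && (sumn a == n).

(* a_j and a_1 + ... + a_j, with the parts numbered from 1. *)
Definition part (a : seq nat) (j : nat) : nat := nth 0%N a j.-1.
Definition psum (a : seq nat) (j : nat) : nat := (\sum_(1 <= i < j.+1) part a i)%N.

(* A_j: points are shifted from {1, ..., n} to {0, ..., n - 1}. *)
Definition blk n (a : seq nat) (j : nat) : {set 'I_n} :=
  [set x : 'I_n | (psum a j.-1 <= x < psum a j)%N].

(* A_1 :|: ... :|: A_j *)
Definition cumblk n (a : seq nat) (j : nat) : {set 'I_n} :=
  (\bigcup_(1 <= i < j.+1) blk n a i)%SET.

(* S_(a_1 + ... + a_j) x S_(a_(j+1)) x ... x S_(a_m): the internal product of
   the symmetric groups on A_1 :|: ... :|: A_j, A_(j+1), ..., A_m. *)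
Definition young_chain n (a : seq nat) (j : nat) : {group 'S_n} :=
  (Sym_group (cumblk n a j) <*>
   \prod_(j.+1 <= i < (size a).+1) Sym_group (blk n a i))%G.

Lemma young_chain_top n (a : seq nat) :
  composition n a -> young_chain n a (size a) = [set: 'S_n] :> {set 'S_n}.
Proof.
case/andP=> _ /eqP sum_a; apply/eqP; rewrite eqEsubset subsetT /=.
apply: subset_trans (joing_subl _ _); apply/subsetP=> s _; rewrite inE.
suff full (x : 'I_n) : x \in cumblk n a (size a).
  by apply/subsetP=> x _; apply: full.
have psum_size : psum a (size a) = n.
  rewrite -sum_a /psum big_add1 /= sumnE [RHS](big_nth 0%N).
  by apply: eq_bigr.
have := ltn_ord x; rewrite -[X in (_ < X)%N -> _]psum_size /cumblk.
elim: (size a) => [|k IHk]; first by rewrite /psum big_geq.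
rewrite [in X in _ -> X]big_nat_recr //= inE => lt_x.
have [/IHk-> // | le_x] := ltnP x (psum a k).
by rewrite [X in _ || X]inE /= le_x lt_x orbT.
Qed.

Definition young_vec (C : numClosedFieldType) n (a : seq nat) (j : nat) :
    'rV[C]_n :=
  sqrtC ((part a j)%:R / ((psum a j.-1)%:R * (psum a j)%:R)) *:
    ind_row C (cumblk n a j.-1)
  - sqrtC ((psum a j.-1)%:R / ((part a j)%:R * (psum a j)%:R)) *:
    ind_row C (blk n a j).

(* Main.v *)
Require Import Defs.
From HB Require Import structures.
From mathcomp Require Import all_boot all_order all_algebra all_fingroup.
From mathcomp Require Import mxrepresentation complex reals.
From mathcomp Require Import ring.
Set Implicit Arguments.
Unset Strict Implicit.
Unset Printing Implicit Defensive.
Local Open Scope ring_scope.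
Import Order.TTheory GRing.Theory Num.Theory.

(** Let [std j] be the space of zero-sum functions supported on
   A_1 :|: ... :|: A_j, and H_j the j-th group of the chain.  As an
   H_j-module, [std j.+1] is the sum of [std j], of the line of [v_(j+1)],
   which consists of the functions in [std j.+1] that H_j fixes, and of the
   zero-sum functions supported on A_(j+1), among which only 0 is fixed by
   K = H_1.  Each nonzero [std j] is irreducible under H_j
   ([std_on_simple]), so an irreducible spherical H_j-submodule of [std j.+1]
   is either [std j] or the line of [v_(j+1)] ([spherical_branching]); this is
   proved without decomposing [std j.+1].

   Hence a flag starts at [std m], the whole representation, and descends
   through [std j] until it enters the line of some [v_k], where it stays
   ([GT_flag_shape]).  It must enter such a line, because [std 1] contains no
   nonzero K-invariant.  The path determines k, since the flag of k is a trivial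
   H_j-module exactly when j < k ([GT_flag_shape_unique]).  Conversely every
   k = 2, ..., m yields a path ([level_path]), so that paths correspond to the
   indices k, and the Gelfand--Tsetlin vector of k spans the line of [v_k].

   What remains is elementary.  The [v_k] are orthogonal because [v_j] has zero
   sum and is supported where each later [v_k] is constant ([young_vec_dot]).  They
   span the invariants because, from a K-invariant of [std j.+1], a multiple of
   [v_(j+1)] can be subtracted that leaves a K-invariant of [std j]
   ([fixed_sub_span]). *)

(** * Subrepresentations as images of injective intertwiners *)

Section Affords.

Variables (C : numClosedFieldType) (gT : finGroupType).
Implicit Types (G H K : {group gT}).

(** Replacing the representation on the submodule by the image of an injective
   intertwiner rids the proofs below of the bases that coordinatize submodules. *)
Lemma affordsP G K n (rG : mx_representation C G n) U (rho : fdrep C K) :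
  affords rG U rho <->
  K \subset G /\ exists T : 'M_(fdrep_dim rho, n),
    [/\ row_free T, (T == U)%MS & {in K, forall g, rho g *m T = T *m rG g}].
Proof.
split=> [[sKG [modU [B dimU freeB defB]]] | [sKG [T [freeT eqTU defT]]]].
  split=> //; exists (val_submod B); split.
  - rewrite val_submodE /row_free mxrankMfree //.
    by rewrite /row_free val_submod1.
  - rewrite -(mxrank_leqif_eq (val_submodP B)) val_submodE mxrankMfree.
      by rewrite (eqP freeB) dimU.
    by rewrite /row_free val_submod1.
  - move=> g Kg; transitivity (val_submod (rho g *m B)).
      exact: mulmxA.
    by rewrite (defB g Kg); apply: (val_submodJ modU).
have sTU : (T <= U)%MS by rewrite (eqmxP eqTU).
have modU : mxmodule (subg_repr rG sKG) U.
  apply/mxmoduleP=> g Kg; rewrite -(eqmxMr _ (eqmxP eqTU)) -(eqmxP eqTU).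
  by rewrite /= -defT // submxMl.
exists sKG, modU; exists (in_submod U T).
- by rewrite -(eqmxP eqTU) (eqP freeT).
- by rewrite /row_free mxrank_in_submod.
- move=> g Kg; rewrite -(in_submodJ modU) //= -defT //.
  by rewrite [in RHS]in_submodE -mulmxA -in_submodE.
Qed.

(** Paths name isomorphism classes; this realizes the next one inside a given
   subspace that realizes the previous one. *)
Lemma affords_lift G H K n (rG : mx_representation C G n) W
    (sigma : fdrep C H) (rho : fdrep C K) :
    affords rG W sigma -> contained_in_Res sigma rho ->
  exists2 U : 'M_n, (U <= W)%MS & affords rG U rho.
Proof.
case/affordsP=> sHG [T [freeT eqTW defT]] [V].
case/affordsP=> sKH [X [freeX _ defX]].
exists <<X *m T>>%MS.
  by rewrite genmxE -(eqmxP eqTW) submxMl.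
apply/affordsP; split; first exact: subset_trans sHG.
exists (X *m T); split.
- by rewrite /row_free mxrankMfree.
- by apply/eqmxP/eqmx_sym/genmxE.
- by move=> g Kg; rewrite mulmxA defX // -!mulmxA defT // (subsetP sKH).
Qed.

(** The intertwiner onto [W] being injective, the one onto [U] factors through it. *)
Lemma affords_contained G H K n (rG : mx_representation C G n) U W
    (sigma : fdrep C H) (rho : fdrep C K) :
    K \subset H -> affords rG W sigma -> affords rG U rho -> (U <= W)%MS ->
  contained_in_Res sigma rho.
Proof.
move=> sKH /affordsP[sHG [T [freeT eqTW defT]]].
case/affordsP=> sKG [S [freeS eqSU defS]] sUW.
have /submxP[X defSX]: (S <= T)%MS by rewrite (eqmxP eqSU) (eqmxP eqTW).
exists <<X>>%MS; apply/affordsP; split=> //; exists X; split.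
- by rewrite /row_free -(mxrankMfree X freeT) -defSX.
- by apply/eqmxP/eqmx_sym/genmxE.
- move=> g Kg; apply: (row_free_inj freeT).
  by rewrite -!mulmxA -defSX defS // defT ?(subsetP sKH) // mulmxA -defSX.
Qed.

Lemma affords_simple G K n (rG : mx_representation C G n) U (rho : fdrep C K)
    (sKG : K \subset G) :
  affords rG U rho -> mx_irreducible rho -> mxsimple (subg_repr rG sKG) U.
Proof.
case=> sKG' [modU simUrho] irr_rho.
by apply/(submod_mx_irr modU)/(mx_rsim_irr simUrho).
Qed.

Lemma affords_fixed G H K n (rG : mx_representation C G n) U (rho : fdrep C K) :
    H \subset K -> affords rG U rho -> rfix_mx rho H != 0 ->
  exists f : 'rV_n, [/\ f != 0, (f <= U)%MS & {in H, forall g, f *m rG g = f}].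
Proof.
move=> sHK /affordsP[sKG [T [freeT eqTU defT]]] nz_fix.
exists (nz_row (rfix_mx rho H) *m T); split.
- by rewrite mulmx_free_eq0 ?nz_row_eq0.
- by rewrite -(eqmxP eqTU) submxMl.
- move=> g Hg; rewrite -mulmxA -defT ?(subsetP sHK) // mulmxA; congr (_ *m _).
  by have /rfix_mxP-> := nz_row_sub (rfix_mx rho H).
Qed.

Lemma affords_rfix_neq0 G H K n (rG : mx_representation C G n) U
    (rho : fdrep C K) (f : 'rV_n) :
    H \subset K -> affords rG U rho -> f != 0 -> (f <= U)%MS ->
    {in H, forall g, f *m rG g = f} ->
  rfix_mx rho H != 0.
Proof.
move=> sHK /affordsP[sKG [T [freeT eqTU defT]]] nz_f; rewrite -(eqmxP eqTU).
case/submxP=> x def_f fix_f; apply: contraNneq nz_f => fix0.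
suffices: (x <= rfix_mx rho H)%MS.
  by rewrite fix0 submx0 def_f => /eqP->; rewrite mul0mx.
apply/rfix_mxP=> g Hg; apply: (row_free_inj freeT).
by rewrite -mulmxA defT ?(subsetP sHK) // mulmxA -def_f fix_f.
Qed.

(** An injective intertwiner with a pointwise fixed image forces [rho] to be
   trivial, hence also every other realization of [rho]. *)
Lemma affords_trivial G K n (rG : mx_representation C G n) U W
    (rho : fdrep C K) :
    affords rG U rho -> affords rG W rho ->
    {in K, forall g, U *m rG g = U} -> {in K, forall g, W *m rG g = W}.
Proof.
case/affordsP=> sKG [T [freeT eqTU defT]].
case/affordsP=> _ [S [freeS eqSW defS]] fixU g Kg.
have /submxP[X defTX]: (T <= U)%MS by rewrite (eqmxP eqTU).
have rho1 : rho g = 1%:M.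
  apply: (row_free_inj freeT).
  by rewrite mul1mx defT // defTX -mulmxA fixU.
have /submxP[Y ->]: (W <= S)%MS by rewrite (eqmxP eqSW).
by rewrite -mulmxA -defS // rho1 mul1mx.
Qed.

Lemma fixed_line_simple (G : {group gT}) n (rG : mx_representation C G n)
    (u : 'rV_n) :
  u != 0 -> {in G, forall g, u *m rG g = u} -> mxsimple rG <<u>>%MS.
Proof.
move=> nz_u fix_u; split=> [||U _ sUu nzU].
- by apply/mxmoduleP=> g Gg; rewrite genmxE (eqmxMr _ (genmxE _)) fix_u.
- by rewrite -mxrank_eq0 genmxE mxrank_eq0.
- have := mxrank_leqif_sup sUu; case=> _ <-; rewrite eqn_leq mxrankS //=.
  rewrite genmxE (leq_trans (rank_leq_row u)) //.
  by rewrite lt0n mxrank_eq0.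
Qed.

End Affords.

(** * Existence of flags *)

Lemma downward_ind (P : nat -> Prop) m : (0 < m)%N -> P m ->
  (forall j, (1 <= j < m)%N -> P j.+1 -> P j) -> P 1%N.
Proof.
case: m => // m _ Pm IH; elim: m Pm IH => // m IHm Pm IH.
apply: IHm => [|j /andP[j_gt0 lt_jm]]; first by apply: IH Pm => /=.
by apply: IH; rewrite j_gt0 ltnW.
Qed.

(** The flag is built from the top down, one [affords_lift] per step. *)
Lemma GT_flag_exists (C : numClosedFieldType) (gT : finGroupType) m
    (H : nat -> {group gT}) n (rG : mx_representation C (H m) n) (V : 'M[C]_n)
    (rho : forall j, fdrep C (H j)) :
  (0 < m)%N -> GT_path rG V rho -> exists W, GT_flag rG V rho W.
Proof.
move=> m_gt0 [_ res_rho Vrho].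
pose partial j := exists W, [/\ (W m == V)%MS,
  forall i, (j <= i < m)%N -> (W i <= W i.+1)%MS
  & forall i, (j <= i <= m)%N -> affords rG (W i) (rho i)].
apply: (@downward_ind partial m) => // [|j j_ok [W [WV leW affW]]].
  exists (fun=> V); split=> [|i /andP[le_mi]|i le_imm]; first by rewrite submx_refl.
    by rewrite ltnNge le_mi.
  by rewrite (_ : i = m) //; apply/eqP; rewrite eqn_leq andbC.
have [j_gt0 lt_jm] := andP j_ok.
have affWj : affords rG (W j.+1) (rho j.+1) by apply: affW; rewrite leqnn.
have [U sUW affU] := affords_lift affWj (res_rho j j_ok).
exists (fun i => if (i <= j)%N then U else W i); split=> [|i|i] /=.
- by rewrite leqNgt lt_jm.
- case/andP; rewrite leq_eqVlt => /predU1P[<- _ | lt_ji lt_im].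
    by rewrite leqnn ltnn.
  by rewrite (ltn_geF lt_ji) (ltn_geF (leqW lt_ji)) leW ?lt_ji.
- case/andP; rewrite leq_eqVlt => /predU1P[<- _ | lt_ji le_im].
    by rewrite leqnn.
  by rewrite (ltn_geF lt_ji); apply: affW; rewrite lt_ji.
Qed.

(** * Zero-sum functions supported on a subset *)

Section StandardOn.

Variables (C : numClosedFieldType) (n : nat).
Implicit Types (A B D : {set 'I_n}) (f : 'rV[C]_n) (s : 'S_n).

Definition std_on A : 'M[C]_n :=
  (std_space C n :&: kermx (diag_mx (ind_row C (~: A))))%MS.

Lemma std_onP A f :
  reflect (\sum_i f 0 i = 0 /\ forall i, i \notin A -> f 0 i = 0)
          (f <= std_on A)%MS.
Proof.
rewrite sub_capmx; apply: (iffP andP) => -[/std_spaceP sum0 supp]; split=> //.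
  move=> i nAi; move/sub_kermxP/matrixP/(_ 0 i): supp.
  by rewrite mul_mx_diag !mxE inE nAi mulr1.
apply/sub_kermxP/matrixP=> i j; rewrite ord1 mul_mx_diag !mxE inE.
by case: (boolP (j \in A)) => [_ | /supp->]; rewrite ?mulr0 ?mul0r.
Qed.

Lemma std_onT : (std_on [set: 'I_n] == std_space C n)%MS.
Proof.
apply/andP; split; first exact: capmxSl.
by apply/rV_subP=> f /std_spaceP sum0; apply/std_onP; split=> // i; rewrite inE.
Qed.

Lemma std_onS A B : A \subset B -> (std_on A <= std_on B)%MS.
Proof.
move=> sAB; apply/rV_subP=> f /std_onP[sum0 supp]; apply/std_onP; split=> // i.
by move=> nBi; apply: supp; apply: contra nBi; apply: subsetP.
Qed.

Lemma std_on_const A f :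
  (f <= std_on A)%MS -> {in A &, forall x y, f 0 x = f 0 y} -> f = 0.
Proof.
case/std_onP=> sum0 supp const_f; apply/rowP=> x; rewrite mxE.
have [Ax | /supp//] := boolP (x \in A).
have: (f 0 x) *+ #|A| = 0.
  rewrite -sumr_const -[RHS]sum0 [RHS](bigID (mem A)) /=.
  rewrite [X in _ + X]big1 // addr0.
  by apply: eq_bigr => y Ay; apply: const_f.
by move/eqP; rewrite mulrn_eq0 (cardD1 x) Ax => /eqP.
Qed.

Lemma fun_repr_tperm (G : {group 'S_n}) f x y i :
  (f *m fun_repr C G (tperm x y)) 0 i = f 0 (tperm x y i).
Proof. by rewrite fun_reprE tpermV. Qed.

Lemma fixed_tperm (G : {group 'S_n}) f x y :
  f *m fun_repr C G (tperm x y) = f -> f 0 x = f 0 y.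
Proof. by move=> fix_f; rewrite -{1}fix_f fun_repr_tperm tpermL. Qed.

Lemma std_on_module (K : {group 'S_n}) A :
  {in K, forall s x, (s x \in A) = (x \in A)} ->
  mxmodule (fun_repr C K) (std_on A).
Proof.
move=> stabA; apply/mxmoduleP=> s Ks; apply/row_subP=> i; rewrite row_mul.
have /std_onP[sum0 supp] := row_sub i (std_on A).
apply/std_onP; split=> [|x nAx]; last first.
  by rewrite fun_reprE supp // stabA ?groupV.
rewrite -[RHS]sum0 [RHS](reindex_inj (@perm_inj _ s^-1%g)).
by apply: eq_bigr => x _; rewrite fun_reprE.
Qed.

(** A nonzero zero-sum function takes distinct values at some x and y; comparing
   it with its image under the transposition of x and y yields the difference
   of the point masses at x and y, whose translates span all of [std_on A]. *)
Lemma std_on_simple (K : {group 'S_n}) A :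
    {in K, forall s x, (s x \in A) = (x \in A)} ->
    {in A &, forall x y, tperm x y \in K} -> std_on A != 0 ->
  mxsimple (fun_repr C K) (std_on A).
Proof.
move=> stabA transpA nzA; split=> // [|U modU sUA nzU]; first exact: std_on_module.
pose f := nz_row U; have Uf : (f <= U)%MS by apply: nz_row_sub.
have [[x y] /= /and3P[Ax Ay neq_fxy]] :
    {p : 'I_n * 'I_n | [&& p.1 \in A, p.2 \in A & f 0 p.1 != f 0 p.2]}.
  apply/sigW; apply/existsP; apply: contraT => /existsPn const_f.
  rewrite -(nz_row_eq0 U) in nzU; case/eqP: nzU.
  apply: (std_on_const (submx_trans Uf sUA)) => x y Ax Ay.
  by move: (const_f (x, y)); rewrite /= Ax Ay negbK => /eqP.
have neq_xy : x != y by apply: contraNneq neq_fxy => ->.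
pose e u : 'rV[C]_n := delta_mx 0 u - delta_mx 0 y.
have Uxy : (e x <= U)%MS.
  have def_e : f - f *m fun_repr C K (tperm x y) = (f 0 x - f 0 y) *: e x.
    apply/rowP=> i; rewrite [LHS]mxE [X in _ + X]mxE fun_repr_tperm !mxE eqxx /=.
    case: (tpermP x y i) => [->|->|/eqP/negPf neq_ix /eqP/negPf neq_iy].
    - by rewrite eqxx (negPf neq_xy) subr0 mulr1.
    - by rewrite eqxx eq_sym (negPf neq_xy) sub0r mulrN1 opprB.
    - by rewrite neq_ix neq_iy !subrr mulr0.
  rewrite -(eqmx_scale (e x) (_ : f 0 x - f 0 y != 0)) ?subr_eq0 // -def_e.
  rewrite addmx_sub // eqmx_opp (mxmodule_trans modU) ?transpA //.
have Ue u : u \in A -> (e u <= U)%MS.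
  move=> Au; have [-> | neq_uy] := eqVneq u y; first by rewrite /e subrr sub0mx.
  have -> : e u = e x *m fun_repr C K (tperm x u).
    apply/rowP=> i; rewrite fun_repr_tperm !mxE eqxx /=.
    rewrite !(canF_eq (tpermK x u)) tpermL.
    by rewrite (tpermD neq_xy neq_uy).
  by rewrite (mxmodule_trans modU) ?transpA.
apply/rV_subP=> g /std_onP[sum_g supp_g].
have -> : g = \sum_u g 0 u *: e u.
  under eq_bigr do rewrite scalerBr.
  by rewrite sumrB -scaler_suml sum_g scale0r subr0 -row_sum_delta.
apply: summx_sub => u _; have [Au | /supp_g->] := boolP (u \in A).
  by rewrite scalemx_sub ?Ue.
by rewrite scale0r sub0mx.
Qed.

End StandardOn.

(** * Blocks of a composition and the chain of Young subgroups *)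

Lemma sub_prodg (gT : finGroupType) (F : nat -> {group gT}) p q i :
  (p <= i < q)%N -> F i \subset (\prod_(p <= k < q) F k)%g.
Proof.
case/andP=> le_pi lt_iq.
have one_in r s : 1%g \in (\prod_(r <= k < s) F k)%g.
  elim/big_ind: _ => [|A B A1 B1|k _]; rewrite ?group1 //.
  by rewrite -[1%g]mulg1 mem_mulg.
rewrite (big_cat_nat le_pi (ltnW lt_iq)) /=; apply/subsetP=> g Fg.
rewrite -[g]mul1g mem_mulg ?one_in // big_ltn //.
by rewrite -[g]mulg1 mem_mulg ?one_in.
Qed.

Section YoungChain.

Variables (n : nat) (a : seq nat).
Hypothesis ha : composition n a.
Implicit Types (x y : 'I_n) (s : 'S_n).

Local Notation H := (young_chain n a).

Lemma psumS j : psum a j.+1 = (psum a j + part a j.+1)%N.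
Proof. by rewrite /psum big_nat_recr. Qed.

Lemma psum0 : psum a 0 = 0%N.
Proof. by rewrite /psum big_geq. Qed.

Lemma leq_psum i j : (i <= j)%N -> (psum a i <= psum a j)%N.
Proof.
move/subnK <-; elim: (j - i)%N => // d IHd.
by rewrite addSn psumS (leq_trans IHd) ?leq_addr.
Qed.

Lemma psum_size : psum a (size a) = n.
Proof.
case/andP: ha => _ /eqP <-; rewrite /psum big_add1 /= sumnE [RHS](big_nth 0%N).
by apply: eq_bigr.
Qed.

Lemma size_gt0 : (0 < n)%N -> (0 < size a)%N.
Proof. by rewrite -psum_size; case: (posnP (size a)) => // ->; rewrite psum0. Qed.

Lemma part_gt0 j : (1 <= j <= size a)%N -> (0 < part a j)%N.
Proof.
by case: j => // j lt_ja; case/andP: ha => /all_nthP-/(_ 0%N j lt_ja).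
Qed.

Lemma psum_gt0 j : (1 <= j <= size a)%N -> (0 < psum a j)%N.
Proof. by case: j => // j /part_gt0 pj_gt0; rewrite psumS addn_gt0 pj_gt0 orbT. Qed.

Lemma mem_cumblk j x : (x \in cumblk n a j) = (x < psum a j)%N.
Proof.
rewrite /cumblk; elim: j => [|j IHj]; first by rewrite !big_geq // inE psum0.
rewrite big_nat_recr //= inE IHj inE psumS /=.
by case: ltnP => // lt_x; rewrite (leq_trans lt_x) ?leq_addr.
Qed.

Lemma mem_blk j x : (x \in blk n a j) = (psum a j.-1 <= x < psum a j)%N.
Proof. by rewrite inE. Qed.

Lemma cumblkS i j : (i <= j)%N -> cumblk n a i \subset cumblk n a j.
Proof.
move=> le_ij; apply/subsetP=> x; rewrite !mem_cumblk => /leq_trans-> //.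
exact: leq_psum.
Qed.

Lemma blk_sub_cumblk i j : (i <= j)%N -> blk n a i \subset cumblk n a j.
Proof.
move=> le_ij; apply: subset_trans (cumblkS le_ij).
by apply/subsetP=> x; rewrite mem_blk mem_cumblk => /andP[].
Qed.

Lemma cumblk_size : cumblk n a (size a) = [set: 'I_n].
Proof. by apply/setP=> x; rewrite mem_cumblk psum_size ltn_ord inE. Qed.

Lemma card_cumblk j : (j <= size a)%N -> #|cumblk n a j| = psum a j.
Proof.
move=> le_ja; have le_pn : (psum a j <= n)%N by rewrite -psum_size leq_psum.
rewrite -sum1_card (eq_bigl (fun x : 'I_n => x < psum a j)%N); last first.
  by move=> x; apply: mem_cumblk.
by rewrite (big_ord_narrow le_pn) sum1_card card_ord.
Qed.

Lemma card_blk j : (1 <= j <= size a)%N -> #|blk n a j| = part a j.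
Proof.
case: j => // j le_ja.
have -> : blk n a j.+1 = cumblk n a j.+1 :\: cumblk n a j.
  by apply/setP=> x; rewrite in_setD !mem_cumblk mem_blk -leqNgt.
rewrite cardsD (setIidPr (cumblkS (leqnSn j))) !card_cumblk ?(ltnW le_ja) //.
by rewrite psumS addKn.
Qed.

Lemma tperm_Sym (T : finType) (A : {set T}) (x y : T) :
  x \in A -> y \in A -> tperm x y \in Sym_group A.
Proof.
move=> Ax Ay; rewrite inE; apply: subset_trans (tperm_on x y) _.
by apply/subsetP=> z /set2P[]->.
Qed.

Lemma SymS (T : finType) (A B : {set T}) : A \subset B -> Sym A \subset Sym B.
Proof.
by move=> sAB; apply/subsetP=> s; rewrite !inE => /subset_trans; apply.
Qed.

Lemma young_chain_subP j (G : {group 'S_n}) :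
  reflect (Sym (cumblk n a j) \subset G /\
           forall i, (j < i <= size a)%N -> Sym (blk n a i) \subset G)
          (H j \subset G).
Proof.
rewrite join_subG; apply: (iffP andP) => -[-> sBG]; split=> //.
  by move=> i lt_ji; apply: subset_trans sBG; apply: sub_prodg.
by rewrite big_nat prod_subG.
Qed.

Lemma young_chainS i j : (i <= j)%N -> H i \subset H j.
Proof.
have /young_chain_subP[sCH sBH] := subxx (H j).
move=> le_ij; apply/young_chain_subP; split=> [|k /andP[lt_ik le_ka]].
  exact: subset_trans (SymS (cumblkS le_ij)) sCH.
have [le_kj | lt_jk] := leqP k j; last by rewrite sBH ?lt_jk.
exact: subset_trans (SymS (blk_sub_cumblk le_kj)) sCH.
Qed.

Lemma young_chain_sub_top j : H j \subset H (size a).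
Proof. by rewrite young_chain_top // subsetT. Qed.

Lemma tperm_cumblk j : {in cumblk n a j &, forall x y, tperm x y \in H j}.
Proof.
have /young_chain_subP[/subsetP sCH _] := subxx (H j).
by move=> x y Cx Cy; apply: sCH; apply: tperm_Sym.
Qed.

Lemma tperm_blk i j : (1 <= i <= size a)%N ->
  {in blk n a i &, forall x y, tperm x y \in H j}.
Proof.
move=> /andP[i_gt0 le_ia] x y Bx By; have [le_ij | lt_ji] := leqP i j.
  by apply: tperm_cumblk; apply: (subsetP (blk_sub_cumblk le_ij)).
have /young_chain_subP[_ /(_ i)] := subxx (H j); rewrite lt_ji le_ia.
by move=> /(_ isT)/subsetP; apply; apply: tperm_Sym.
Qed.

(** Each factor of [H j] moves only points of a set that is contained in
   [cumblk n a l] or disjoint from it. *)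
Lemma young_chain_stab j l : (j <= l)%N ->
  {in H j, forall s x, (s x \in cumblk n a l) = (x \in cumblk n a l)}.
Proof.
move=> le_jl s Hs x; set D := cumblk n a l.
suffices: H j \subset 'N(D | 'P)%g.
  by move/subsetP/(_ s Hs)/astabs_act; apply.
have stab (B : {set 'I_n}) :
    (B \subset D) || [disjoint B & D] -> Sym B \subset 'N(D | 'P)%g.
  move=> BD; apply/subsetP=> t; rewrite inE => onBt; apply/astabsP=> y /=.
  rewrite /aperm; have [By | nBy] := boolP (y \in B); last first.
    by rewrite (out_perm onBt).
  have tBy : t y \in B by rewrite (perm_closed _ onBt).
  case/orP: BD => [/subsetP sBD | dBD]; first by rewrite !sBD.
  by rewrite !(disjointFr dBD).
apply/young_chain_subP; split=> [|i /andP[lt_ji _]]; apply: stab.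
  by rewrite cumblkS.
have [le_il | lt_li] := leqP i l; first by rewrite blk_sub_cumblk.
apply/orP; right; rewrite disjoint_subset; apply/subsetP=> y.
rewrite mem_blk inE mem_cumblk -leqNgt => /andP[le_y _].
by apply: leq_trans le_y; apply: leq_psum; rewrite -ltnS (ltn_predK lt_li).
Qed.

End YoungChain.

(** * The vectors [young_vec] *)

Section YoungVectors.

Variables (C : numClosedFieldType) (n : nat) (a : seq nat).
Hypothesis ha : composition n a.

Local Notation H := (young_chain n a).
Local Notation v := (young_vec C n a).

(** The first equation makes the sum of [young_vec] vanish, the second one makes
   its norm 1. *)
Lemma young_coef (p q : nat) (al := sqrtC (q%:R / (p%:R * (p + q)%:R)) : C)
    (be := sqrtC (p%:R / (q%:R * (p + q)%:R)) : C) :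
    (0 < p)%N -> (0 < q)%N ->
  [/\ 0 < al, 0 < be, al * p%:R = be * q%:R
    & al * al * p%:R + be * be * q%:R = 1].
Proof.
move=> p_gt0 q_gt0; have pC : 0 < p%:R :> C by rewrite ltr0n.
have qC : 0 < q%:R :> C by rewrite ltr0n.
have pqC : 0 < (p + q)%:R :> C by rewrite natrD addr_gt0.
have al0 : 0 < al by rewrite sqrtC_gt0 divr_gt0 ?mulr_gt0.
have be0 : 0 < be by rewrite sqrtC_gt0 divr_gt0 ?mulr_gt0.
have [p0 q0 pq0] : [/\ p%:R != 0 :> C, q%:R != 0 :> C & p%:R + q%:R != 0 :> C].
  by rewrite -natrD !gt_eqF.
split=> //; last first.
  by rewrite -!expr2 !sqrtCK natrD; field; rewrite p0 q0 pq0.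
apply/eqP; rewrite -(@eqrXn2 _ 2) ?mulr_ge0 ?ltW //; apply/eqP.
by rewrite !exprMn !sqrtCK natrD; field; rewrite p0 q0 pq0.
Qed.

Lemma young_coefS j : (1 <= j < size a)%N ->
  exists al be : C,
    [/\ 0 < al, 0 < be, al * (psum a j)%:R = be * (part a j.+1)%:R,
        al * al * (psum a j)%:R + be * be * (part a j.+1)%:R = 1
      & v j.+1 = al *: ind_row C (cumblk n a j) - be *: ind_row C (blk n a j.+1)].
Proof.
case/andP=> j_gt0 lt_ja; rewrite /young_vec /= psumS.
have pj_gt0 : (0 < psum a j)%N by rewrite (psum_gt0 ha) ?j_gt0 ?(ltnW lt_ja).
have [c1 c2 c3 c4] := young_coef pj_gt0 (part_gt0 ha (j := j.+1) lt_ja).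
exact: (ex_intro _ _ (ex_intro _ _ (And5 c1 c2 c3 c4 erefl))).
Qed.

Lemma sum_ind_row (A : {set 'I_n}) : \sum_i ind_row C A 0 i = #|A|%:R.
Proof.
rewrite -sum1_card natr_sum [RHS]big_mkcond; apply: eq_bigr => i _.
by rewrite mxE; case: (i \in A).
Qed.

Lemma blk_notin_cumblk j x : x \in blk n a j.+1 -> x \notin cumblk n a j.
Proof. by rewrite mem_blk mem_cumblk -leqNgt => /andP[]. Qed.

Lemma young_row_cumblk j (al be : C) :
  {in cumblk n a j, forall x, (al *: ind_row C (cumblk n a j)
                               - be *: ind_row C (blk n a j.+1)) 0 x = al}.
Proof.
move=> x Cx; have /negPf nBx : x \notin blk n a j.+1.
  by apply: contraL Cx; apply: blk_notin_cumblk.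
by rewrite !mxE Cx nBx mulr1 mulr0 subr0.
Qed.

Lemma young_row_blk j (al be : C) :
  {in blk n a j.+1, forall x, (al *: ind_row C (cumblk n a j)
                               - be *: ind_row C (blk n a j.+1)) 0 x = - be}.
Proof.
move=> x Bx.
by rewrite !mxE Bx (negPf (blk_notin_cumblk Bx)) mulr1 mulr0 sub0r.
Qed.

Lemma notin_cumblkS j x :
  (x \notin cumblk n a j.+1) = (x \notin cumblk n a j) && (x \notin blk n a j.+1).
Proof.
by rewrite /cumblk big_nat_recr //= in_setU negb_or.
Qed.

Lemma young_vec_std j : (1 <= j < size a)%N ->
  (v j.+1 <= std_on C (cumblk n a j.+1))%MS.
Proof.
move=> j_ok; have [al [be [_ _ bal _ ->]]] := young_coefS j_ok.
have [j_gt0 lt_ja] := andP j_ok; apply/std_onP; split=> [|x nCx].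
  rewrite (eq_bigr (fun i => al * ind_row C (cumblk n a j) 0 i
                             - be * ind_row C (blk n a j.+1) 0 i)); last first.
    by move=> i _; rewrite !mxE.
  rewrite sumrB -!mulr_sumr !sum_ind_row (card_cumblk ha) ?(ltnW lt_ja) //.
  by rewrite (card_blk ha) // bal subrr.
move: nCx; rewrite notin_cumblkS => /andP[/negPf nCx /negPf nBx].
by rewrite !mxE nCx nBx !mulr0 subrr.
Qed.

Lemma young_vec_fixed (G : {group 'S_n}) i j : (i <= j)%N ->
  {in H i, forall s, v j.+1 *m fun_repr C G s = v j.+1}.
Proof.
move=> le_ij s Hs; apply/rowP=> x; rewrite fun_reprE !mxE.
have Hs' : (s^-1)%g \in H i by rewrite groupV.
have eq_blk y : (y \in blk n a j.+1)
    = (y \in cumblk n a j.+1) && (y \notin cumblk n a j).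
  by rewrite mem_blk !mem_cumblk -leqNgt andbC.
rewrite !eq_blk !(young_chain_stab le_ij Hs').
by rewrite (young_chain_stab (leqW le_ij) Hs').
Qed.

(** Subtracting the multiple of [v j.+1] that agrees with the function on
   [cumblk n a j] leaves a constant zero-sum function on [blk n a j.+1]. *)
Lemma young_vec_span j (f : 'rV[C]_n) : (1 <= j < size a)%N ->
    (f <= std_on C (cumblk n a j.+1))%MS ->
    {in cumblk n a j &, forall x y, f 0 x = f 0 y} ->
    {in blk n a j.+1 &, forall x y, f 0 x = f 0 y} ->
  (f <= v j.+1)%MS.
Proof.
move=> j_ok std_f const_C const_B.
have [j_gt0 lt_ja] := andP j_ok; have le_ja := ltnW lt_ja.
have std_v := young_vec_std j_ok.
have [al [be [al_gt0 _ _ _ def_v]]] := young_coefS j_ok.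
have v_on_C : {in cumblk n a j, forall x, v j.+1 0 x = al}.
  by rewrite def_v; apply: young_row_cumblk.
have v_on_B : {in blk n a j.+1, forall x, v j.+1 0 x = - be}.
  by rewrite def_v; apply: young_row_blk.
have [x0 Cx0] : exists x0, x0 \in cumblk n a j.
  by apply/card_gt0P; rewrite (card_cumblk ha) // (psum_gt0 ha) ?j_gt0.
pose c := f 0 x0 / al; have: f - c *: v j.+1 = 0; last first.
  by move/subr0_eq->; apply: scalemx_sub.
have entry x : (f - c *: v j.+1) 0 x = f 0 x - c * v j.+1 0 x.
  by rewrite mxE [X in _ + X]mxE [X in - X]mxE.
apply: (@std_on_const _ _ (blk n a j.+1)) => [|x y Bx By]; last first.
  by rewrite !entry !v_on_B // (const_B x y).
have /std_onP[sum0 supp] : (f - c *: v j.+1 <= std_on C (cumblk n a j.+1))%MS.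
  by rewrite addmx_sub // eqmx_opp scalemx_sub.
apply/std_onP; split=> // x nBx; have [Cx | nCx] := boolP (x \in cumblk n a j).
  rewrite entry v_on_C //.
  by rewrite (const_C x x0) // divfK ?subrr // gt_eqF.
by apply: supp; rewrite notin_cumblkS nCx.
Qed.

Lemma dotC_conj (f g : 'rV[C]_n) : dotC g f = (dotC f g)^*.
Proof.
by rewrite rmorph_sum; apply: eq_bigr => i _; rewrite rmorphM /= conjCK mulrC.
Qed.

Lemma dotC_ind_row (f : 'rV[C]_n) (A B : {set 'I_n}) (al be : C) :
    0 < al -> 0 < be ->
  dotC f (al *: ind_row C A - be *: ind_row C B)
    = al * (\sum_(x in A) f 0 x) - be * (\sum_(x in B) f 0 x).
Proof.
move=> al_gt0 be_gt0; rewrite [X in al * X]big_mkcond [X in be * X]big_mkcond.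
rewrite !mulr_sumr -sumrB; apply: eq_bigr => x _.
rewrite !mxE rmorphB !rmorphM /= !conjC_nat !geC0_conj ?ltW //.
by case: (x \in A); case: (x \in B); rewrite ?mulr0 ?mulr1 ?subr0 ?mulrBr; ring.
Qed.

(** For j < k, [v j] has zero sum and is supported where [v k] is constant. *)
Lemma young_vec_dot j k : (2 <= j <= size a)%N -> (2 <= k <= size a)%N ->
  dotC (v j) (v k) = (j == k)%:R.
Proof.
wlog le_jk : j k / (j <= k)%N => [wlog_jk j_ok k_ok|].
  have [/wlog_jk-> // | /ltnW/wlog_jk dot_kj] := leqP j k.
  by rewrite dotC_conj dot_kj // conjC_nat eq_sym.
case: j k le_jk => [|j] [|k] // le_jk j_ok k_ok.
have [al [be [al_gt0 be_gt0 bal nor def_v]]] := young_coefS k_ok.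
rewrite [v k.+1]def_v dotC_ind_row //.
have [eq_jk | neq_jk] := eqVneq j k.
  subst j; rewrite eqxx; have [_ lt_ka] := andP k_ok.
  rewrite (eq_bigr (fun=> al)); last by rewrite def_v; apply: young_row_cumblk.
  rewrite [X in _ - be * X](eq_bigr (fun=> - be)); last first.
    by rewrite def_v; apply: young_row_blk.
  rewrite !sumr_const (card_cumblk ha (ltnW lt_ka)) (card_blk ha) //.
  rewrite -nor -[al *+ _]mulr_natr -[(- be) *+ _]mulr_natr.
  by rewrite mulNr mulrN opprK !mulrA.
rewrite eqSS (negPf neq_jk); have lt_jk : (j < k)%N by rewrite ltn_neqAle neq_jk.
have /std_onP[sum0 supp] := young_vec_std j_ok.
have suppk x : x \notin cumblk n a k -> v j.+1 0 x = 0.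
  by move=> nCx; apply: supp; apply: contra nCx; apply/subsetP/cumblkS.
rewrite [X in _ - be * X]big1 => [|x /blk_notin_cumblk/suppk//].
rewrite mulr0 subr0 [X in al * X](_ : _ = 0) ?mulr0 //.
by rewrite -[RHS]sum0 [RHS](bigID (mem (cumblk n a k))) /= [X in _ + X]big1 ?addr0.
Qed.

Lemma young_vec_neq0 j : (2 <= j <= size a)%N -> v j != 0.
Proof.
move=> j_ok; apply: contraTneq isT => v0; have /eqP := young_vec_dot j_ok j_ok.
rewrite eqxx v0 /dotC big1 => [|i _]; last by rewrite mxE mul0r.
by rewrite eq_sym oner_eq0.
Qed.

End YoungVectors.

(** * Branching of the standard representation along the chain *)

Section Branching.

Variables (C : numClosedFieldType) (n : nat) (a : seq nat).
Hypothesis ha : composition n a.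

Local Notation m := (size a).
Local Notation H := (young_chain n a).
Local Notation v := (young_vec C n a).
Local Notation std j := (std_on C (cumblk n a j)).
Local Notation rG := (fun_repr C (H m)).

Lemma fixed_cumblk j (f : 'rV[C]_n) :
  {in H j, forall s, f *m rG s = f} ->
  {in cumblk n a j &, forall x y, f 0 x = f 0 y}.
Proof. by move=> fix_f x y Cx Cy; apply/fixed_tperm/fix_f/tperm_cumblk. Qed.

Lemma fixed_blk i (f : 'rV[C]_n) : (1 <= i <= m)%N ->
  {in H 1, forall s, f *m rG s = f} ->
  {in blk n a i &, forall x y, f 0 x = f 0 y}.
Proof.
by move=> i_ok fix_f x y Bx By; apply/fixed_tperm/fix_f/(tperm_blk _ i_ok).
Qed.

Lemma std_cumblk_module i j : (i <= j)%N -> mxmodule (fun_repr C (H i)) (std j).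
Proof. by move=> le_ij; apply: std_on_module; apply: young_chain_stab. Qed.

Lemma std_cumblk_simple j : std j != 0 -> mxsimple (fun_repr C (H j)) (std j).
Proof.
by apply: std_on_simple; [apply: young_chain_stab | apply: tperm_cumblk].
Qed.

(** The functions in [U] whose sum over [cumblk n a j] vanishes form a
   submodule.  If it is zero, then [f *m rG s - f], which lies in it, vanishes
   for all [f] in [U] and [s] in [H j], so [U] consists of invariants.
   Otherwise it is [U], and then a spherical vector of [U], being constant on
   [blk n a j.+1] with zero sum there, lies in [std j]. *)
Lemma spherical_branching j (U : 'M[C]_n) (f : 'rV[C]_n) :
    (1 <= j < m)%N -> mxsimple (fun_repr C (H j)) U -> (U <= std j.+1)%MS ->
    f != 0 -> (f <= U)%MS -> {in H 1, forall s, f *m rG s = f} ->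
  (U == std j)%MS \/ (U == v j.+1)%MS.
Proof.
move=> j_ok simU sU nz_f Uf fix_f; have [modU nzU minU] := simU.
have [j_gt0 lt_ja] := andP j_ok.
pose sumC := (ind_row C (cumblk n a j))^T.
have sumCE (g : 'rV_n) : g *m sumC = (\sum_(x in cumblk n a j) g 0 x)%:M.
  apply/matrixP=> i k; rewrite !ord1 !mxE /= mulr1n [RHS]big_mkcond.
  by apply: eq_bigr => x _; rewrite !mxE; case: (x \in _); rewrite ?mulr1 ?mulr0.
have sumCJ (g : 'rV_n) s :
    s \in H j -> g *m fun_repr C (H j) s *m sumC = g *m sumC.
  move=> Hs; rewrite !sumCE; congr (_%:M).
  rewrite [RHS](reindex_inj (@perm_inj _ s^-1%g)).
  apply: eq_big => [x|x _]; last exact: fun_reprE.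
  by rewrite (young_chain_stab (leqnn j)) ?groupV.
pose W := (U :&: kermx sumC)%MS.
have memW (g : 'rV_n) : (g <= W)%MS = (g <= U)%MS && (g *m sumC == 0).
  by rewrite sub_capmx; congr (_ && _); apply: sameP sub_kermxP eqP.
have modW : mxmodule (fun_repr C (H j)) W.
  apply/mxmoduleP=> s Hs; apply/row_subP=> i; rewrite row_mul.
  have := row_sub i W; rewrite !memW => /andP[Ui /eqP sum_i].
  by rewrite (mxmodule_trans modU) // sumCJ // sum_i eqxx.
have [W0 | nzW] := eqVneq W 0.
  have fixU (g : 'rV_n) : (g <= U)%MS -> {in H j, forall s, g *m rG s = g}.
    move=> Ug s Hs; apply/subr0_eq/eqP; rewrite -submx0 -W0 memW.
    rewrite addmx_sub ?eqmx_opp ?(mxmodule_trans modU) //=.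
    by rewrite mulmxBl sumCJ // subrr.
  have sUv : (U <= v j.+1)%MS.
    apply/rV_subP=> g Ug; apply: young_vec_span => //.
    - exact: submx_trans Ug sU.
    - exact/fixed_cumblk/fixU.
    - apply: fixed_blk => // s Hs; apply: fixU => //.
      exact: (subsetP (young_chainS n a j_gt0)).
  right; rewrite sUv /=.
  have /sub_rVP[c def_f] := submx_trans Uf sUv.
  have nz_c : c != 0 by apply: contraNneq nz_f => c0; rewrite def_f c0 scale0r.
  by rewrite -(eqmx_scale _ nz_c) -def_f.
left.
have := submx_trans Uf (minU W modW (capmxSl _ _) nzW).
rewrite memW Uf /= sumCE => /eqP/matrixP/(_ 0 0); rewrite !mxE mulr1n => sumCf.
have /std_onP[sum_f supp_f] := submx_trans Uf sU.
have std_f : (f <= std j)%MS.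
  (* As [f] vanishes off [cumblk n a j.+1], [g] is its restriction to
     [blk n a j.+1]. *)
  pose g : 'rV[C]_n := \row_x (if x \in cumblk n a j then 0 else f 0 x).
  have g0 : g = 0.
    apply: (@std_on_const _ _ (blk n a j.+1)) => [|x y Bx By]; last first.
      rewrite !mxE !(negPf (blk_notin_cumblk _)) //.
      by apply: (@fixed_blk j.+1).
    apply/std_onP; split=> [|x nBx]; last first.
      rewrite mxE; case: ifPn => // nCx.
      by apply: supp_f; rewrite notin_cumblkS nCx.
    rewrite -[RHS]sum_f [RHS](bigID (mem (cumblk n a j))) /= sumCf add0r.
    by rewrite [RHS]big_mkcond; apply: eq_bigr => x _; rewrite mxE if_neg.
  apply/std_onP; split=> // x nCx.
  by have /rowP/(_ x) := g0; rewrite !mxE (negPf nCx).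
have nz_std : std j != 0 by apply: contraNneq nz_f => std0; rewrite -submx0 -std0.
have [modS _ minS] := std_cumblk_simple nz_std.
have sUS : (U <= std j)%MS.
  apply: submx_trans (capmxSr U (std j)); apply: minU.
  - exact: capmx_module.
  - exact: capmxSl.
  - by apply: contraNneq nz_f => cap0; rewrite -submx0 -cap0 sub_capmx Uf.
by rewrite sUS minS.
Qed.

End Branching.

(** * Gelfand--Tsetlin flags and basis of the standard representation *)

Section Flags.

Variables (C : numClosedFieldType) (n : nat) (a : seq nat).
Hypothesis ha : composition n a.

Local Notation m := (size a).
Local Notation H := (young_chain n a).
Local Notation v := (young_vec C n a).
Local Notation std j := (std_on C (cumblk n a j)).
Local Notation rG := (fun_repr C (H m)).
Local Notation V := (std_space C n).

(** The j-th member of the flag that leaves the chain of the [std j] for the line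
   of [v k] on passing from [k] to [k - 1]. *)
Definition level k j : 'M[C]_n := if (j < k)%N then <<v k>>%MS else std j.

Lemma level_vec k j : (2 <= k <= m)%N -> (1 <= j <= m)%N ->
  exists f : 'rV[C]_n,
    [/\ f != 0, (f <= level k j)%MS & {in H 1, forall s, f *m rG s = f}].
Proof.
move=> k_ok j_ok; exists (v (if (j < k)%N then k else j)).
rewrite /level; case: ltnP => [lt_jk | le_kj].
  case: k k_ok lt_jk => // k k_ok lt_jk.
  split; [exact: young_vec_neq0 | by rewrite genmxE |].
  by case/andP: k_ok => ? _; apply: young_vec_fixed.
have [/leq_trans/(_ le_kj) j_gt1 _] := andP k_ok.
have{j_ok} j_ok : (2 <= j <= m)%N by rewrite j_gt1; case/andP: j_ok.
case: j {le_kj} j_gt1 j_ok => // j j_gt1 j_ok; split.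
- exact: young_vec_neq0.
- exact: young_vec_std.
- exact: young_vec_fixed.
Qed.

Lemma level_simple k j : (2 <= k <= m)%N -> (1 <= j <= m)%N ->
  mxsimple (fun_repr C (H j)) (level k j).
Proof.
move=> k_ok j_ok; have [f [nz_f le_f _]] := level_vec k_ok j_ok.
have nzL : level k j != 0.
  by apply: contraNneq nz_f => L0; rewrite -submx0 -L0.
move: nzL; rewrite /level; case: ltnP => [lt_jk | le_kj]; last first.
  exact: std_cumblk_simple.
case: k k_ok lt_jk {f nz_f le_f} => // k k_ok lt_jk _.
apply: fixed_line_simple; first exact: young_vec_neq0.
by move=> s Hs; apply: (@young_vec_fixed _ _ a _ j k).
Qed.

Lemma level_top k : (2 <= k <= m)%N -> (level k m == V)%MS.
Proof.
by case/andP=> _ le_km; rewrite /level ltnNge le_km /= cumblk_size // std_onT.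
Qed.

Lemma levelS k j : (2 <= k <= m)%N -> (1 <= j < m)%N ->
  (level k j <= level k j.+1)%MS.
Proof.
move=> k_ok /andP[j_gt0 lt_jm]; rewrite /level.
have [lt_jk | le_kj | <-] := ltngtP j.+1 k; last 1 first.
- by rewrite genmxE young_vec_std // j_gt0.
- by rewrite submx_refl.
- by rewrite std_onS ?cumblkS.
Qed.

(** Descending from the top, [spherical_branching] lets the flag either go on to
   the next [std j] or drop into a line, which has no proper nonzero subspace.
   The first case cannot last down to [std 1], whose invariants are constant and
   so vanish. *)
Lemma GT_flag_shape rho W :
    (0 < m)%N -> GT_path rG V rho -> GT_flag rG V rho W ->
  exists2 k, (2 <= k <= m)%N & forall j, (1 <= j <= m)%N -> (W j == level k j)%MS.
Proof.
move=> m_gt0 [sph_rho _ _] [WV leW affW].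
have fixW j : (1 <= j <= m)%N -> exists f : 'rV_n,
    [/\ f != 0, (f <= W j)%MS & {in H 1, forall s, f *m rG s = f}].
  move=> j_ok; have [_ nz_fix] := sph_rho j j_ok; have [j_gt0 _] := andP j_ok.
  exact: affords_fixed (young_chainS n a j_gt0) (affW j j_ok) nz_fix.
have simW j : (1 <= j <= m)%N -> mxsimple (fun_repr C (H j)) (W j).
  move=> j_ok; have [irr_rho _] := sph_rho j j_ok.
  exact: affords_simple (young_chain_sub_top ha j) (affW j j_ok) irr_rho.
pose shape j := (forall i, (j <= i <= m)%N -> (W i == std i)%MS) \/
  exists2 k, (j < k <= m)%N & forall i, (j <= i <= m)%N -> (W i == level k i)%MS.
have: shape 1%N.
  apply: (@downward_ind shape m) => // [|j j_ok].
    left=> i; rewrite -eqn_leq => /eqP<-.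
    rewrite cumblk_size //; apply/eqmxP/(eqmx_trans (eqmxP WV))/eqmx_sym/eqmxP.
    exact: std_onT.
  have [j_gt0 lt_jm] := andP j_ok.
  have j_ok' : (1 <= j <= m)%N by rewrite j_gt0 ltnW.
  have [f [nz_f Wf fix_f]] := fixW j j_ok'.
  case=> [shape_std | [k /andP[lt_jk le_km] shape_k]].
    have /eqmxP eqWj1 : (W j.+1 == std j.+1)%MS by rewrite shape_std ?leqnn.
    have sWstd : (W j <= std j.+1)%MS by rewrite -eqWj1 leW.
    have [eqWj | eqWj] :=
      spherical_branching ha j_ok (simW j j_ok') sWstd nz_f Wf fix_f.
      left=> i /andP[]; rewrite leq_eqVlt => /predU1P[<- // | lt_ji le_im].
      by rewrite shape_std ?lt_ji.
    right; exists j.+1; rewrite ?leqnn // => i /andP[].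
    rewrite leq_eqVlt => /predU1P[<- _ | lt_ji le_im]; rewrite /level.
      by rewrite leqnn; apply/eqmxP/(eqmx_trans (eqmxP eqWj))/eqmx_sym/genmxE.
    by rewrite ltnNge lt_ji shape_std ?lt_ji.
  right; exists k => [|i /andP[]]; first by rewrite ltnW.
  rewrite leq_eqVlt => /predU1P[<- _ | lt_ji le_im]; last by rewrite shape_k ?lt_ji.
  have /eqmxP eqWj1 : (W j.+1 == level k j.+1)%MS by rewrite shape_k ?leqnn.
  have k_ok : (2 <= k <= m)%N by rewrite (leq_trans _ lt_jk).
  have eq_level : level k j.+1 = level k j by rewrite /level lt_jk ltnW.
  have sWjL : (W j <= level k j)%MS by rewrite -eq_level -eqWj1 leW.
  have [_ _ minL] := level_simple k_ok j_ok'.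
  by have [modW nzW _] := simW j j_ok'; rewrite sWjL minL.
case=> [shape_std | [k k_ok shape_k]]; last by exists k.
have [f [/eqP nz_f Wf fix_f]] := fixW 1%N m_gt0.
case: nz_f; apply: (@std_on_const _ _ (cumblk n a 1)).
  by rewrite -(eqmxP (shape_std 1%N _)).
exact: fixed_cumblk.
Qed.

(** If k < k', the member of index k is a trivial module for the flag of k', but
   not for the flag of k, in which it contains [v k]: a function on
   [cumblk n a k] fixed by [H k] is constant there. *)
Lemma GT_flag_shape_unique rho W W' k k' :
    GT_flag rG V rho W -> GT_flag rG V rho W' ->
    (2 <= k <= m)%N -> (2 <= k' <= m)%N ->
    (forall j, (1 <= j <= m)%N -> (W j == level k j)%MS) ->
    (forall j, (1 <= j <= m)%N -> (W' j == level k' j)%MS) ->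
  k = k'.
Proof.
wlog lt_kk' : k k' W W' / (k < k')%N => [wlog_k|].
  move=> flW flW' k_ok k'_ok shW shW'; case: (ltngtP k k') => // lt_kk'.
    exact: wlog_k flW flW' _ _ shW shW'.
  by apply/esym; apply: wlog_k flW' flW _ _ shW' shW.
move=> [_ _ affW] [_ _ affW'] k_ok k'_ok shW shW'; exfalso.
have k_ok1 : (1 <= k <= m)%N by case/andP: k_ok => /ltnW-> ->.
have fixW' : {in H k, forall s, W' k *m rG s = W' k}.
  move=> s Hs; have: (W' k <= v k')%MS.
    by rewrite (eqmxP (shW' k k_ok1)) /level lt_kk' genmxE.
  case/submxP=> X ->; rewrite -mulmxA; congr (_ *m _).
  case: k' lt_kk' {shW' k'_ok} => // k' le_kk'.
  exact: (@young_vec_fixed _ _ a _ k k').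
have fixW := affords_trivial (affW' k k_ok1) (affW k k_ok1) fixW'.
have std_v : (v k <= std k)%MS.
  by case: k k_ok {lt_kk' shW k_ok1 fixW fixW'} => // k; apply: young_vec_std.
have vW : (v k <= W k)%MS by rewrite (eqmxP (shW k k_ok1)) /level ltnn.
have /eqP[] := young_vec_neq0 C ha k_ok.
apply: (std_on_const std_v).
apply: fixed_cumblk => s Hs; have /submxP[X ->] := vW.
by rewrite -mulmxA fixW.
Qed.

End Flags.

Section Basis.

Variables (C : numClosedFieldType) (n : nat) (a : seq nat).
Hypotheses (n_gt0 : (0 < n)%N) (ha : composition n a).

Local Notation m := (size a).
Local Notation H := (young_chain n a).
Local Notation v := (young_vec C n a).
Local Notation std j := (std_on C (cumblk n a j)).
Local Notation rG := (fun_repr C (H m)).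
Local Notation V := (std_space C n).
Local Notation level := (level C n a).

Lemma level_module k j (sHG : H j \subset H m) : (0 < k)%N ->
  mxmodule (subg_repr rG sHG) (level k j).
Proof.
case: k => // k _; rewrite /level; case: ltnP => [le_jk | _].
  apply/mxmoduleP=> s Hs; rewrite genmxE (eqmxMr _ (genmxE _)).
  by rewrite [_ *m _](@young_vec_fixed _ _ a (H m) j k).
exact: std_cumblk_module.
Qed.

Lemma level_path k : (2 <= k <= m)%N ->
  exists2 rho, GT_path rG V rho & GT_flag rG V rho (level k).
Proof.
move=> k_ok; have k_gt0 : (0 < k)%N by case/andP: k_ok => /ltnW.
pose modL j := level_module (young_chain_sub_top ha j) k_gt0.
pose rho j := FdRep (submod_repr (modL j)).
have affL j : affords rG (level k j) (rho j).
  by exists (young_chain_sub_top ha j), (modL j); apply: mx_rsim_refl.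
exists rho; last by split=> // [|j j_ok]; [apply: level_top | apply: levelS].
split=> [j j_ok|j j_ok|].
- have [f [nz_f Lf fix_f]] := level_vec C ha k_ok j_ok; split.
    by apply/(submod_mx_irr (modL j))/level_simple.
  apply: (affords_rfix_neq0 _ (affL j) nz_f Lf fix_f).
  by apply: young_chainS; case/andP: j_ok.
- apply: (affords_contained _ (affL j.+1) (affL j)); last exact: levelS.
  exact: young_chainS.
- have := affL m; rewrite /rho => /affordsP[sHG [T [freeT eqTL defT]]].
  apply/affordsP; split=> //; exists T; split=> //.
  exact/eqmxP/(eqmx_trans (eqmxP eqTL))/eqmxP/level_top.
Qed.

(** An invariant of [std j.+1] is constant on [blk n a j.+1], where [v j.+1] is a
   nonzero constant; subtracting a multiple of [v j.+1] cancels it there. *)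
Lemma fixed_sub_span (S : 'M[C]_n) j (f : 'rV[C]_n) :
    (forall k, (2 <= k <= m)%N -> (v k <= S)%MS) -> (1 <= j <= m)%N ->
    (f <= std j)%MS -> {in H 1, forall s, f *m rG s = f} ->
  (f <= S)%MS.
Proof.
move=> sub_vS; elim: j f => // j IHj f; case: (posnP j) => [-> _ std_f fix_f|].
  by rewrite (std_on_const std_f (fixed_cumblk fix_f)) sub0mx.
move=> j_gt0 /= lt_jm std_f fix_f.
have j_ok : (1 <= j < m)%N by rewrite j_gt0.
have [al [be [_ be_gt0 _ _ def_v]]] := young_coefS C ha j_ok.
have v_on_B : {in blk n a j.+1, forall x, v j.+1 0 x = - be}.
  by rewrite def_v; apply: young_row_blk.
have [x Bx] : exists x, x \in blk n a j.+1.
  by apply/card_gt0P; rewrite (card_blk ha) // (part_gt0 ha).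
pose c := f 0 x / v j.+1 0 x; rewrite -[f](subrK (c *: v j.+1)).
have Sv : (v j.+1 <= S)%MS by apply: sub_vS; rewrite ltnS j_gt0.
rewrite addmx_sub ?(scalemx_sub _ Sv) // IHj ?j_gt0 ?(ltnW lt_jm) //; last first.
  move=> s Hs; rewrite mulmxBl -scalemxAl fix_f //.
  by rewrite (@young_vec_fixed _ _ a _ 1 j).
have /std_onP[sum0 supp] : (f - c *: v j.+1 <= std j.+1)%MS.
  by rewrite addmx_sub // eqmx_opp scalemx_sub ?young_vec_std.
apply/std_onP; split=> // y nCy; have [By | nBy] := boolP (y \in blk n a j.+1).
  rewrite mxE [X in _ + X]mxE [X in - X]mxE v_on_B // /c v_on_B //.
  rewrite divfK ?oppr_eq0 ?gt_eqF // (fixed_blk _ fix_f By Bx) ?subrr //.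
by apply: supp; rewrite notin_cumblkS nCy.
Qed.

Theorem young_vec_GT_basis :
  is_GT_basis m H rG V [seq v j | j <- rev (iota 2 m.-1)].
Proof.
have m_gt0 := size_gt0 ha n_gt0.
set t := rev _; pose s := [seq v j | j <- t].
have mem_t k : (k \in t) = (2 <= k <= m)%N.
  by rewrite mem_rev mem_iota add2n prednK // ltnS.
have uniq_t : uniq t by rewrite rev_uniq iota_uniq.
have mem_s k : (2 <= k <= m)%N -> v k \in s by rewrite -mem_t; apply: map_f.
have uniq_flag rho : GT_path rG V rho -> exists2 k, (2 <= k <= m)%N &
    forall W, GT_flag rG V rho W ->
      forall j, (1 <= j <= m)%N -> (W j == level k j)%MS.
  move=> path_rho; have [W flW] := GT_flag_exists m_gt0 path_rho.
  have [k k_ok shW] := GT_flag_shape ha m_gt0 path_rho flW.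
  exists k => // W' flW'.
  have [k' k'_ok shW'] := GT_flag_shape ha m_gt0 path_rho flW'.
  by rewrite (GT_flag_shape_unique ha flW flW' k_ok k'_ok shW shW').
split.
- move=> i k; rewrite size_map => lt_i lt_k; rewrite !(nth_map 0%N) //.
  by rewrite young_vec_dot ?nth_uniq // -mem_t mem_nth.
- apply/andP; split.
    rewrite big_map big_seq; elim/big_ind: _ => [|A B sA sB|k]; first exact: sub0mx.
      by rewrite addsmx_sub sA.
    rewrite mem_t; case: k => // k k_ok; rewrite genmxE sub_capmx.
    have [k_gt0 le_km] := andP k_ok.
    rewrite (submx_trans (young_vec_std C ha k_ok)) ?capmxSl //=.
    by apply/rfix_mxP; apply: (@young_vec_fixed _ _ a _ 1 k).
  apply/rV_subP=> f; rewrite sub_capmx => /andP[Vf /rfix_mxP fix_f].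
  apply: (@fixed_sub_span _ m) fix_f; rewrite ?m_gt0 //=; last first.
    by rewrite cumblk_size // (eqmxP (std_onT C n)).
  move=> k; rewrite -mem_t => tk.
  rewrite big_map (bigD1_seq k) //=; apply: submx_trans (addsmxSl _ _).
  by rewrite genmxE.
- move=> rho path_rho; split; first exact: GT_flag_exists.
  have [k _ eq_level] := uniq_flag rho path_rho.
  move=> W W' flW flW' j j_ok; apply/eqmxP.
  apply: eqmx_trans (eqmxP (eq_level W flW j j_ok)) _.
  exact/eqmx_sym/eqmxP/eq_level.
- move=> rho path_rho; have [k k_ok eq_level] := uniq_flag rho path_rho.
  have flag1 W (u : 'rV[C]_n) :
      GT_flag rG V rho W -> (u <= W 1%N)%MS = (u <= v k)%MS.
    move=> flW; rewrite (eqmxP (eq_level W flW 1%N m_gt0)) /level.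
    by case/andP: k_ok => -> _; rewrite genmxE.
  exists (v k); split.
    split; first exact: mem_s.
    have [W flW] := GT_flag_exists m_gt0 path_rho; exists W; split=> //.
      by rewrite (flag1 W _ flW).
    by rewrite young_vec_dot // eqxx.
  move=> _ [/mapP[k' + ->] [W [flW + _]]]; rewrite mem_t (flag1 W _ flW) => k'_ok.
  case/sub_rVP=> c def_v; have [-> // | neq_kk'] := eqVneq k k'.
  have /eqP := young_vec_dot C ha k'_ok k'_ok; rewrite eqxx {1}def_v.
  have -> : dotC (c *: v k) (v k') = c * dotC (v k) (v k').
    by rewrite mulr_sumr; apply: eq_bigr => i _; rewrite mxE mulrA.
  by rewrite young_vec_dot // (negPf neq_kk') mulr0 eq_sym oner_eq0.
- move=> _ /mapP[k + ->]; rewrite mem_t => k_ok.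
  have [rho path_rho flL] := level_path k_ok; exists rho; split=> //.
  exists (level k); split=> //; last by rewrite young_vec_dot // eqxx.
  by rewrite /level; case/andP: k_ok => -> _; rewrite genmxE.
Qed.

End Basis.

Theorem theorem3p1 (R : realType) (n : nat) (a : seq nat)
    (n_gt0 : (0 < n)%N) (ha : composition n a) :
  is_GT_basis (size a) (young_chain n a)
    (fun_repr R[i] (young_chain n a (size a))) (std_space R[i] n)
    [seq young_vec R[i] n a j | j <- rev (iota 2 (size a).-1)].
Proof. exact: young_vec_GT_basis. Qed.
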